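(* For every finite generating set $X$ of the free inverse monoid $\mathrm{FIM}_1$ of rank $1$, the word problem $\mathrm{WP}(\mathrm{FIM}_1,X)$ and the two-tape word problem $\iota(\mathrm{FIM}_1,X)$ are both ET0L.
   Context: A monoid $M$ is inverse if for every $x\in M$ there is a unique $y\in M$ (the inverse $x^{-1}$ of $x$) with $xyx=x$ and $yxy=y$. For a set $X$, let $X^{-1}=\{\overline{x}\mid x\in X\}$ be a disjoint set of formal inverses and $X^{\pm}=X\cup X^{-1}$; put $x^{-1}=\overline{x}$ and $\overline{x}^{-1}=x$ for $x\in X$, and for a word $w=w_1\cdots w_n$ with $w_i\in X^{\pm}$ put $w^{\mathrm{inv}}=w_n^{-1}\cdots w_1^{-1}$. The free inverse monoid $\mathrm{FIM}(X)$ is the free object on $X$ in the variety of inverse monoids, i.e. the quotient of $(X^{\pm})^*$ by the relations $u=uu^{\mathrm{inv}}u$ and $uu^{\mathrm{inv}}vv^{\mathrm{inv}}=vv^{\mathrm{inv}}uu^{\mathrm{inv}}$ for $u,v\in (X^{\pm})^*$. If $|X|=k$ it is denoted $\mathrm{FIM}_k$. If $M$ is an inverse monoid and $X\subseteq M$ is a finite set generating $M$ as an inverse monoid, words over $X^{\pm}$ are evaluated in $M$ by interpreting $\overline{x}$ as the inverse of $x$, and $u=_M v$ means that $u$ and $v$ represent the same element of $M$. With $\#$ a symbol not in $X^{\pm}$, $$\mathrm{WP}(M,X)=\{u\#v^{\mathrm{inv}}\mid u,v\in (X^{\pm})^*,\ u=_M v\},$$ $$\iota(M,X)=\{(u,v)\in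 (X^{\pm})^*\times (X^{\pm})^*\mid u=_M v\}.$$ An ET0L system consists of finite disjoint sets $V$ of nonterminals and $\Sigma$ of terminals, a start symbol $S\in V$, and a finite collection of tables, each table being a finite set of productions $N\to\alpha$ with $N\in V$, $\alpha\in (V\cup\Sigma)^*$, containing at least one production from every nonterminal. A derivation step consists of choosing one table and replacing every nonterminal occurrence in the current string simultaneously by the right-hand side of some production from that table for that nonterminal (different occurrences of the same nonterminal may use different productions of the table). The language generated is the set of words in $\Sigma^*$ derivable from $S$; a language is ET0L if it is generated by some ET0L system. A relation $R\subseteq A^*\times A^*$ ($A$ a finite alphabet) is called ET0L if it is the image of an ET0L language over the alphabet $\{(a,\varepsilon),(\varepsilon,a)\mid a\in A\}$ under the natural homomorphism to $A^*\times A^*$. *)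

(* Defs.v *)
From HB Require Import structures.
From mathcomp Require Import all_boot finmap boolp.
From Stdlib Require Import Relation_Operators.

Set Implicit Arguments.
Unset Strict Implicit.
Unset Printing Implicit Defensive.

Local Open Scope group_scope.

(* The *-monoid laws of the structure below follow from inverseP; they are
   inherited so that the library's lemmas on x^-1 apply. *)
HB.mixin Record Monoid_isInverseMonoid M of Monoid M & BaseGroup M := {
  inverseP : forall x y : M, (x * y * x = x /\ y * x * y = y) <-> y = x^-1
}.

#[short(type="inverseMonoidType")]
HB.structure Definition InverseMonoid :=
  {M of Monoid_isInverseMonoid M & StarMonoid M}.

(* [inl x] is the letter x and [inr x] is its formal inverse. *)
Notation sword A := (seq (A + A)%type).

Definition linv A (a : A + A) : A + A :=
  match a with inl x => inr x | inr x => inl x end.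

Definition winv A (w : sword A) : sword A := rev (map (@linv A) w).

Lemma winvK A : involutive (@winv A).
Proof.
move=> w; rewrite /winv map_rev revK -map_comp -[RHS]map_id.
by apply: eq_map => -[].
Qed.

Lemma winv_cat A (u v : sword A) : winv (u ++ v) = winv v ++ winv u.
Proof. by rewrite /winv map_cat rev_cat. Qed.

Section FreeInverseMonoid.
Variable X : choiceType.
Implicit Types u v w : sword X.

Inductive fim_cong : sword X -> sword X -> Prop :=
| fim_refl u : fim_cong u u
| fim_sym u v : fim_cong u v -> fim_cong v u
| fim_trans v u w : fim_cong u v -> fim_cong v w -> fim_cong u w
| fim_cat u u' v v' :
    fim_cong u u' -> fim_cong v v' -> fim_cong (u ++ v) (u' ++ v')
| fim_reg u : fim_cong u (u ++ winv u ++ u)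
| fim_comm u v :
    fim_cong (u ++ winv u ++ v ++ winv v) (v ++ winv v ++ u ++ winv u).

Definition fim_rel : rel (sword X) := fun u v => `[< fim_cong u v >].

Lemma fim_rel_refl : reflexive fim_rel.
Proof. by move=> u; apply/asboolP/fim_refl. Qed.

Lemma fim_rel_sym : symmetric fim_rel.
Proof. by move=> u v; apply/asboolP/asboolP => /fim_sym. Qed.

Lemma fim_rel_trans : transitive fim_rel.
Proof.
by move=> v u w /asboolP uv /asboolP vw; apply/asboolP/(fim_trans uv vw).
Qed.

Canonical fim_equiv := EquivRel fim_rel fim_rel_refl fim_rel_sym fim_rel_trans.

Local Open Scope quotient_scope.

Definition FIM := {eq_quot fim_equiv}.
HB.instance Definition _ := Choice.on FIM.

Definition fim_class (w : sword X) : FIM := \pi_{eq_quot fim_equiv} w.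
Definition fim_repr (x : FIM) : sword X := repr (x : {eq_quot fim_equiv}).

Lemma fim_classP u v : fim_class u = fim_class v <-> fim_cong u v.
Proof. by split=> [/eqmodP/asboolP | uv]; last exact/eqmodP/asboolP. Qed.

Lemma fim_reprK : cancel fim_repr fim_class.
Proof. by move=> x; rewrite /fim_class reprK. Qed.

Definition fim_one : FIM := fim_class [::].
Definition fim_mul (x y : FIM) : FIM := fim_class (fim_repr x ++ fim_repr y).
Definition fim_inv (x : FIM) : FIM := fim_class (winv (fim_repr x)).

Lemma fim_cong_winv u v : fim_cong u v -> fim_cong (winv u) (winv v).
Proof.
elim=> {u v} [u|u v _ uv|v u w _ uv _ vw|u u' v v' _ uu' _ vv'|u|u v].
- exact: fim_refl.
- exact: fim_sym.
- exact: fim_trans uv vw.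
- by rewrite !winv_cat; apply: fim_cat.
- by rewrite !winv_cat -catA; apply: fim_reg.
- by rewrite !winv_cat !winvK -!catA; apply: fim_comm.
Qed.

Lemma fim_mulE u v : fim_mul (fim_class u) (fim_class v) = fim_class (u ++ v).
Proof. by apply/fim_classP/fim_cat; apply/fim_classP; rewrite fim_reprK. Qed.

Lemma fim_invE u : fim_inv (fim_class u) = fim_class (winv u).
Proof. by apply/fim_classP/fim_cong_winv/fim_classP; rewrite fim_reprK. Qed.

Lemma fim_mulA : associative fim_mul.
Proof.
move=> x y z; rewrite -(fim_reprK x) -(fim_reprK y) -(fim_reprK z).
by rewrite !fim_mulE catA.
Qed.

Lemma fim_mul1 : left_id fim_one fim_mul.
Proof. by move=> x; rewrite -(fim_reprK x) fim_mulE. Qed.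

Lemma fim_mulr1 : right_id fim_one fim_mul.
Proof. by move=> x; rewrite -(fim_reprK x) fim_mulE cats0. Qed.

HB.instance Definition _ := isMonoid.Build FIM fim_mulA fim_mul1 fim_mulr1.
HB.instance Definition _ := hasInv.Build FIM fim_inv.

Implicit Types x y e f : FIM.

Lemma fim_invK x : x^-1^-1 = x.
Proof. by rewrite -(fim_reprK x) /inv /= !fim_invE winvK. Qed.

Lemma fim_invM x y : (x * y)^-1 = y^-1 * x^-1.
Proof.
rewrite -(fim_reprK x) -(fim_reprK y) /inv /mul /=.
by rewrite !(fim_mulE, fim_invE) winv_cat.
Qed.

HB.instance Definition _ := Monoid_isStarMonoid.Build FIM fim_invK fim_invM.

Lemma fim_mulVK x : x * x^-1 * x = x.
Proof.
rewrite -(fim_reprK x) /inv /mul /= !(fim_mulE, fim_invE) -catA.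
exact/fim_classP/fim_sym/fim_reg.
Qed.

Lemma fim_VmulV x : x^-1 * x * x^-1 = x^-1.
Proof. by have := fim_mulVK x^-1; rewrite fim_invK. Qed.

Lemma fim_mulVC x y : (x * x^-1) * (y * y^-1) = (y * y^-1) * (x * x^-1).
Proof.
rewrite -(fim_reprK x) -(fim_reprK y) /inv /mul /= !(fim_mulE, fim_invE).
by rewrite -!catA; apply/fim_classP/fim_comm.
Qed.

Lemma fim_idem_inv e : e * e = e -> e * e^-1 = e.
Proof.
move=> ee; have e'e' : e^-1 * e^-1 = e^-1 by rewrite -fim_invM ee.
have C := fim_mulVC e e^-1; rewrite fim_invK in C.
have e_eq : e = e^-1.
  transitivity (e * e^-1 * (e^-1 * e)).
    by rewrite mulgA -(mulgA e) e'e' fim_mulVK.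
  by rewrite C mulgA -(mulgA e^-1 e e) ee fim_VmulV.
by rewrite -e_eq.
Qed.

Lemma fim_idemC e f : e * e = e -> f * f = f -> e * f = f * e.
Proof.
move=> /fim_idem_inv ee /fim_idem_inv ff.
by have := fim_mulVC e f; rewrite ee ff.
Qed.

Lemma fim_inverseP x y : (x * y * x = x /\ y * x * y = y) <-> y = x^-1.
Proof.
split=> [[xyx yxy] | ->]; last by rewrite fim_mulVK fim_VmulV.
have idl (a b : FIM) : a * b * a = a -> (a * b) * (a * b) = a * b.
  by move=> aba; rewrite mulgA aba.
have Cr : (x * y) * (x * x^-1) = (x * x^-1) * (x * y).
  by apply: fim_idemC; apply: idl; rewrite ?fim_mulVK.
have Cl : (y * x) * (x^-1 * x) = (x^-1 * x) * (y * x).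
  by apply: fim_idemC; apply: idl; rewrite ?fim_VmulV.
have xyV : x * y = x * x^-1.
  by rewrite -{1}(fim_mulVK x) -[LHS]mulgA -Cr mulgA xyx.
have yxV : y * x = x^-1 * x.
  by rewrite -{1}(fim_mulVK x) -(mulgA x) (mulgA y) Cl -mulgA (mulgA x) xyx.
by rewrite -yxy yxV -mulgA xyV mulgA fim_VmulV.
Qed.

HB.instance Definition _ := Monoid_isInverseMonoid.Build FIM fim_inverseP.

End FreeInverseMonoid.

Notation FIM_ k := (FIM 'I_k).

Section WordProblems.
Variables (M : inverseMonoidType) (X : {fset M}).

Definition inv_generates : Prop :=
  forall S : M -> Prop,
    S 1 -> (forall x y, S x -> S y -> S (x * y)) -> (forall x, S x -> S x^-1) ->
    (forall x, x \in X -> S x) -> forall x, S x.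

Definition weval (w : sword X) : M :=
  \prod_(a <- w) match a with inl x => val x | inr x => (val x)^-1 end.

(* [None] is the separator #. *)
Definition WP (w : seq (option (X + X))) : Prop :=
  exists u v : sword X,
    weval u = weval v /\ w = map Some u ++ None :: map Some (winv v).

Definition two_tape_WP (u v : sword X) : Prop := weval u = weval v.

End WordProblems.

Arguments WP {M} X w.
Arguments two_tape_WP {M} X u v.

Record et0l_system (T : finType) := ET0LSystem {
  nonterm : finType;
  start : nonterm;
  tables : {fset {fset nonterm * seq (nonterm + T)}};
  tables_total : forall t, t \in tables ->
    forall N : nonterm, exists alpha, (N, alpha) \in t
}.

Section ET0L.
Variables (T : finType) (G : et0l_system T).

Inductive table_step (t : {fset nonterm G * seq (nonterm G + T)}) :
    seq (nonterm G + T) -> seq (nonterm G + T) -> Prop :=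
| step_nil : table_step t [::] [::]
| step_term a s s' : table_step t s s' -> table_step t (inr a :: s) (inr a :: s')
| step_nonterm N alpha s s' : (N, alpha) \in t ->
    table_step t s s' -> table_step t (inl N :: s) (alpha ++ s').

Definition et0l_step (s s' : seq (nonterm G + T)) : Prop :=
  exists2 t, t \in tables G & table_step t s s'.

Definition et0l_lang (w : seq T) : Prop :=
  clos_refl_trans _ et0l_step [:: inl (start G)] (map inr w).

End ET0L.

Definition is_ET0L (T : finType) (L : seq T -> Prop) : Prop :=
  exists G : et0l_system T, forall w, L w <-> et0l_lang G w.

(* In a word over [A + A], [inl a] stands for (a, epsilon) and [inr a] for
   (epsilon, a). *)
Definition tape1 A (w : seq (A + A)) : seq A :=
  pmap (fun c => match c with inl a => Some a | inr _ => None end) w.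
Definition tape2 A (w : seq (A + A)) : seq A :=
  pmap (fun c => match c with inl _ => None | inr a => Some a end) w.

Definition is_ET0L_rel (A : finType) (R : seq A -> seq A -> Prop) : Prop :=
  exists2 L : seq (A + A) -> Prop, is_ET0L L &
    forall u v, R u v <-> exists2 w, L w & u = tape1 w /\ v = tape2 w.

(* Main.v *)
(* A word over X evaluates in FIM_1 to the pair of the interval [-a, b] swept by
   a walk on the integers started at 0 and of the end point of that walk (Munn);
   so u#v^inv is in the word problem iff u leads from 0 to some z, v^inv leads
   from z back to 0, and both walks sweep exactly [-a, b].  An ET0L system
   generates such closed walks cell by cell, away from 0: at each cell, an
   excursion beyond the cell is left as one nonterminal naming its end states,
   and all the excursions on one side of 0 are unfolded in parallel by
   the same tables, so that they share the same end point -a or b.  Touching an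
   end of the interval is a nonterminal that may be erased only at that end.
   For the two-tape problem, the walks of u and v from 0 to z are cut at their
   last exits from 0, 1, ..., z - 1 and the pieces are generated alternately. *)
Require Import Defs.
From mathcomp Require Import all_boot finmap boolp.
From Stdlib Require Import Relation_Operators Operators_Properties.

Set Implicit Arguments.
Unset Strict Implicit.
Unset Printing Implicit Defensive.

(** * Level grammars *)

Section LevelGrammar.
Variables (S K T : finType) (prod : S -> K -> seq (T + bool * K) -> Prop).
Variables (m : nat) (final : K -> Prop) (k0 : K).
Hypothesis size_prod : forall s k f, prod s k f -> size f <= m.

Implicit Types (s : S) (tau : seq S) (k : K) (w : seq T).

Notation cur k := (inr (false, k)).
Notation nxt k := (inr (true, k)).

(** The tape [tau] lists the cell labels from the current cell on. It is an index of the judgment,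
    so all symbols of a form unfold along one and the same tape, which is what the tables of an ET0L
    system impose. *)
Inductive gen : seq S -> seq (T + bool * K) -> seq T -> Prop :=
| gen_nil tau : gen tau [::] [::]
| gen_term tau a f w : gen tau f w -> gen tau (inl a :: f) (a :: w)
| gen_cur s tau k g f w1 w2 : prod s k g -> gen (s :: tau) g w1 ->
    gen (s :: tau) f w2 -> gen (s :: tau) (cur k :: f) (w1 ++ w2)
| gen_final k f w : final k -> gen [::] f w -> gen [::] (cur k :: f) w
| gen_nxt s tau k f w1 w2 : gen tau [:: cur k] w1 ->
    gen (s :: tau) f w2 -> gen (s :: tau) (nxt k :: f) (w1 ++ w2).

Lemma gen_cat tau f g w1 w2 :
  gen tau f w1 -> gen tau g w2 -> gen tau (f ++ g) (w1 ++ w2).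
Proof.
move=> fw1;
  elim: {tau f w1} fw1 => //= [tau a f w _ IH|s tau k h f w1 w3|k f w|].
- by move/IH; apply: gen_term.
- by move=> kh hw1 _ _ IH /IH; rewrite -catA; apply: gen_cur kh hw1.
- by move=> kF _ IH /IH; apply: gen_final.
- by move=> s tau k f w1 w3 kw1 _ _ IH /IH; rewrite -catA; apply: gen_nxt.
Qed.

Lemma gen_finalE k w : gen [::] [:: cur k] w -> final k /\ w = [::].
Proof.
move=> kw; inversion kw as [| | |k' f w' kF fw|]; subst.
by split=> //; inversion fw.
Qed.

Section Semantics.
Variable J : seq S -> K -> seq T -> Prop.

Fixpoint form_sem tau (f : seq (T + bool * K)) w : Prop :=
  match f with
  | [::] => w = [::]
  | a :: f' => exists w1 w2, [/\ w = w1 ++ w2,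
      match a with
      | inl t => w1 = [:: t]
      | cur k => J tau k w1
      | nxt k => 0 < size tau /\ J (behead tau) k w1
      end & form_sem tau f' w2]
  end.

Lemma gen_sem : (forall k, final k -> J [::] k [::]) ->
  (forall s tau k f w, prod s k f -> form_sem (s :: tau) f w ->
     J (s :: tau) k w) ->
  forall tau k w, gen tau [:: cur k] w -> J tau k w.
Proof.
move=> Jfinal Jprod tau k w kw.
suff: form_sem tau [:: cur k] w by case=> w1 [_ [-> ? ->]]; rewrite cats0.
elim: kw => {tau k w} //=.
- by move=> tau a f w _ fw; exists [:: a], w.
- by move=> s tau k g f w1 w2 kg _ gw1 _ fw2; exists w1, w2; split; eauto.
- by move=> k f w kF _ fw; exists [::], w; split; eauto.
- move=> s tau k f w1 w2 _ [w1' [w' [-> kw1 ->]]] _ fw2.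
  by exists w1', w2; rewrite cats0.
Qed.

End Semantics.

(* [Some (Some s, k)] is k being expanded in a cell labelled s,
   [Some (None, k)] is k waiting for the next cell, and [None] is a dead end. *)
Definition level_nt : finType := option (option S * K).

Definition level_sym s (a : T + bool * K) : level_nt + T :=
  match a with
  | inl t => inr t
  | inr (b, k) => inl (Some (if b then None else Some s, k))
  end.

(** The table [None] works inside a cell, [Some (Some s)] enters a cell labelled [s], and
    [Some None] ends the tape. A symbol still being expanded when one of the latter two is applied
    can only become the dead end; this synchronises all branches. *)
Inductive level_tab :
    option (option S) -> level_nt -> seq (level_nt + T) -> Prop :=
| tab_id N : level_tab None N [:: inl N]
| tab_prod s k f : prod s k f ->
    level_tab None (Some (Some s, k)) (map (level_sym s) f)
| tab_fail i N : level_tab (Some i) N [:: inl None]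
| tab_final k : final k -> level_tab (Some None) (Some (None, k)) [::]
| tab_next s k :
    level_tab (Some (Some s)) (Some (None, k)) [:: inl (Some (Some s, k))].

(** The successor in [m.+1] leaves room for the one-symbol right-hand sides of [tab_id], [tab_fail]
    and [tab_next] when [m = 0]. *)
Definition level_table i : {fset level_nt * seq (level_nt + T)} :=
  [fset p in [seq (q.1, val q.2) | q : level_nt * m.+1.-bseq (level_nt + T)%type]
   | `[< level_tab i p.1 p.2 >]]%fset.

Lemma level_tableP i N f :
  reflect (level_tab i N f) ((N, f) \in level_table i).
Proof.
rewrite !inE /=; apply: (iffP andP) => [[_ /asboolP]//|tNf].
split; last exact/asboolP.
have fm : size f <= m.+1.
  by case: tNf => //= s k g /size_prod; rewrite size_map; apply: leqW.
by apply/imageP; exists (N, Bseq fm).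
Qed.

Definition level_tables :=
  [fset t in [seq level_table i | i : option (option S)]]%fset.

Lemma level_tablesP t :
  reflect (exists i, t = level_table i) (t \in level_tables).
Proof.
by rewrite inE; apply: (iffP codomP).
Qed.

Lemma level_tables_total t : t \in level_tables ->
  forall N, exists f, (N, f) \in t.
Proof.
move=> /level_tablesP[[i|] ->] N.
  by exists [:: inl None]; apply/level_tableP; constructor.
by exists [:: inl N]; apply/level_tableP; constructor.
Qed.

Definition level_system : et0l_system T :=
  ET0LSystem (Some (None, k0)) level_tables_total.

Local Notation sent := (seq (level_nt + T)).

(** Invariant of a derivation: [w] is what [f] can still become if the tables to come describe the
    cells [tau]. *)
Fixpoint sent_sem tau (f : sent) w : Prop :=
  match f with
  | [::] => w = [::]
  | a :: f' => exists w1 w2, [/\ w = w1 ++ w2,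
      match a with
      | inr t => w1 = [:: t]
      | inl (Some (Some s, k)) => gen (s :: tau) [:: cur k] w1
      | inl (Some (None, k)) => gen tau [:: cur k] w1
      | inl None => False
      end & sent_sem tau f' w2]
  end.

Lemma sent_sem_cat tau f g w : sent_sem tau (f ++ g) w <->
  exists w1 w2, [/\ w = w1 ++ w2, sent_sem tau f w1 & sent_sem tau g w2].
Proof.
elim: f w => [|a f IH] w /=.
  by split=> [|[_ [w2 [-> -> //]]]]; exists [::], w.
split=> [[w1 [_ [-> aw1 /IH[w2 [w3 [-> fw2 gw3]]]]]]|].
  by exists (w1 ++ w2), w3; rewrite catA; split=> //; exists w1, w2.
case=> _ [w3 [-> [w1 [w2 [-> aw1 fw2]]] gw3]].
by exists w1, (w2 ++ w3); rewrite catA; split=> //; apply/IH; exists w2, w3.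
Qed.

Lemma sent_sem_gen s tau f w :
  sent_sem tau (map (level_sym s) f) w -> gen (s :: tau) f w.
Proof.
elim: f w => [|[t|[[] k]] f IH] w /=; first by move->; constructor.
- by case=> _ [w2 [-> -> /IH]]; constructor.
- by case=> w1 [w2 [-> kw1 /IH]]; constructor.
- by case=> w1 [w2 [-> kw1 /IH]]; apply: (gen_cat (f := [:: _])).
Qed.

Lemma sent_sem_term tau w : sent_sem tau (map inr w) w.
Proof. by elim: w => //= a w IH; exists [:: a], w. Qed.

Definition tape_before i tau :=
  match i with
  | None => tau
  | Some None => [::]
  | Some (Some s) => s :: tau
  end.

(** Derivations are read backwards: undoing a table puts the label it consumed back on the tape.
    Before the final table the tape is empty whatever [tau] is, since no live nonterminal survives
    that table. *)
Lemma table_step_sem i tau (f f' : sent) w :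
  table_step (G := level_system) (level_table i) f f' ->
  sent_sem tau f' w -> sent_sem (tape_before i tau) f w.
Proof.
move=> ff'; elim: {f f'} ff' w => //= [a f f' _ IH w|N h f f' + _ IH w].
  by case=> _ [w2 [-> -> /IH ?]]; exists [:: a], w2.
move=> /level_tableP Nh /sent_sem_cat[w1 [w2 [-> hw1 /IH fw2]]].
exists w1, w2; split=> //; case: Nh hw1 => {IH fw2 N h i}.
- case=> [[[s|] k]|] /= [w3 [w4 [E kw3 E4]]]; last by [].
    by rewrite E E4 cats0.
  by rewrite E E4 cats0.
- move=> s k g kg /sent_sem_gen gw1; rewrite -[w1]cats0.
  by apply: gen_cur kg gw1 _; constructor.
- by move=> i N /= [? [? []]].
- by move=> k kF -> /=; apply: gen_final kF _; constructor.
- by move=> s k /= [w3 [w4 [-> ? ->]]]; rewrite cats0.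
Qed.

Local Notation steps := (clos_refl_trans sent (et0l_step (G := level_system))).

Lemma steps_sem f w : steps f (map inr w) -> exists tau, sent_sem tau f w.
Proof.
move Eg: (map _ _) => g /(@clos_rt_rt1n _ _ _ _) fg.
elim: fg Eg => {f g} [f <-|f f1 f2 [t /level_tablesP[i ->] ff1] _ IH].
  by exists [::]; apply: sent_sem_term.
by move=> /IH[tau f1w]; exists (tape_before i tau); apply: table_step_sem f1w.
Qed.

Lemma table_step_id f : table_step (G := level_system) (level_table None) f f.
Proof.
elim: f => [|[N|t] f IH]; [exact: step_nil| |exact: step_term].
by apply: (step_nonterm (alpha := [:: _])) => //; apply/level_tableP;
  constructor.
Qed.

Definition waiting (f : sent) :=
  all (fun a => match a with inl (Some (None, _)) | inr _ => true | _ => false end)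
    f.

Definition waits tau (f : sent) w :=
  exists f', [/\ clos_refl_trans _ (table_step (G := level_system)
                                      (level_table None)) f f',
                 waiting f' & sent_sem tau f' w].

(** The identity productions of the table [None] let the two halves be expanded one after the other,
    although a step rewrites every nonterminal. *)
Lemma waits_cat tau f g w1 w2 :
  waits tau f w1 -> waits tau g w2 -> waits tau (f ++ g) (w1 ++ w2).
Proof.
have stepC f1 f2 g1 : table_step (G := level_system) (level_table None) f1 f2 ->
    table_step (G := level_system) (level_table None) (f1 ++ g1) (f2 ++ g1).
  elim=> {f1 f2} /= [|a f1 f2 _|N h f1 f2 Nh _].
  - exact: table_step_id.
  - exact: step_term.
  - by rewrite -catA; apply: step_nonterm.
have stepL f1 g1 g2 : table_step (G := level_system) (level_table None) g1 g2 ->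
    table_step (G := level_system) (level_table None) (f1 ++ g1) (f1 ++ g2).
  move=> g12; elim: f1 => //= -[N|a] f1 IH; last exact: step_term.
  apply: (step_nonterm (alpha := [:: _])) => //.
  by apply/level_tableP; constructor.
move=> [f' [ff' f'wait f'w]] [g' [gg' g'wait g'w]]; exists (f' ++ g').
split; last by apply/sent_sem_cat; exists w1, w2.
  apply: (@rt_trans _ _ _ (f' ++ g)).
    elim: ff' {f'wait f'w} => {f f'} [f f' ff'|f|f1 f2 f3 _ IH1 _].
    - exact/rt_step/stepC.
    - exact: rt_refl.
    - exact: rt_trans.
  elim: gg' {g'wait g'w} => {g g'} [g g' gg'|g|g1 g2 g3 _ IH1 _].
  - exact/rt_step/stepL.
  - exact: rt_refl.
  - exact: rt_trans.
by rewrite /waiting all_cat; apply/andP.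
Qed.

Lemma gen_waits s tau f w : gen (s :: tau) f w ->
  waits tau (map (level_sym s) f) w.
Proof.
move: {1 3}(s :: tau) (erefl (s :: tau)) => tau' tau'E fw.
elim: {tau' f w} fw tau'E => //=.
- move=> _ _; exists [::]; split=> //; exact: rt_refl.
- move=> tau' a f w _ IH /IH; apply: (waits_cat (f := [:: _]) (w1 := [:: a])).
  exists [:: inr a]; split=> //; first exact: rt_refl.
  by exists [:: a], [::].
- move=> s' tau' k g f w1 w2 kg _ IHg _ IHf E; rewrite -cat1s.
  apply: waits_cat (IHf E); have [g' [gg' g'wait g'w]] := IHg E.
  exists g'; split=> //; apply: rt_trans gg'; apply: rt_step.
  rewrite -[map _ g]cats0; apply: step_nonterm; last exact: step_nil.
  by apply/level_tableP; case: E kg => -> _ kg; constructor.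
- move=> s' tau' k f w1 w2 kw1 _ _ IHf E; rewrite -cat1s.
  apply: waits_cat (IHf E); exists [:: inl (Some (None, k))].
  split=> //; first exact: rt_refl.
  by case: E kw1 => _ -> kw1; exists w1, [::]; rewrite cats0.
Qed.

Lemma sent_sem_waits s tau f w : waiting f -> sent_sem (s :: tau) f w ->
  exists2 f', table_step (G := level_system) (level_table (Some (Some s))) f f'
    & waits tau f' w.
Proof.
elim: f w => [|a f IH] w /= => [_ ->|/andP[aW /IH{}IH]].
  exists [::]; first exact: step_nil.
  by exists [::]; split=> //; apply: rt_refl.
case=> w1 [w2 [-> aw1 /IH[f' ff' f'w]]].
case: a aW aw1 => [[[[//|] k]|//]|t] _ => [kw1|->].
  exists (inl (Some (Some s, k)) :: f').
    apply: (step_nonterm (alpha := [:: _])) ff'.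
    by apply/level_tableP; constructor.
  apply: (waits_cat (f := [:: _])) f'w.
  exact: (gen_waits (f := [:: cur k])).
exists (inr t :: f'); first exact: step_term.
apply: (waits_cat (f := [:: _])) f'w; exists [:: inr t].
by split=> //; [apply: rt_refl|exists [:: t], [::]].
Qed.

(** Induction on the tape: for each label one table enters the cell, then the table [None] is
    repeated until every nonterminal waits again; the final table closes the derivation. *)
Lemma waiting_steps tau f w : waiting f -> sent_sem tau f w ->
  steps f (map inr w).
Proof.
elim: tau f w => [|s tau IH] f w fW fw.
  apply: rt_step; exists (level_table (Some None)).
    by apply/level_tablesP; exists (Some None).
  elim: f fW w fw => [_ _ ->|a f IH]; first exact: step_nil.
  rewrite /= => /andP[aW /IH{}IH] _ [w1 [w2 [-> aw1 /IH fw2]]].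
  case: a aW aw1 => [[[[//|] k]|//]|t] _ => [kw1|->]; last exact: step_term.
  have [kF ->] := gen_finalE kw1.
  apply: (step_nonterm (alpha := [::])) => //.
  by apply/level_tableP; constructor.
have [f1 ff1 [f2 [f12 f2W /(IH _ _ f2W)]]] := sent_sem_waits fW fw.
have f1f2 : steps f1 f2.
  elim: f12 => {ff1 f2W} [g g' gg'|g|g1 g2 g3 _ IH1 _].
  - by apply: rt_step; exists (level_table None) => //; apply/level_tablesP;
      exists None.
  - exact: rt_refl.
  - exact: rt_trans.
apply: rt_trans; apply: rt_trans f1f2; apply: rt_step.
by exists (level_table (Some (Some s))) => //; apply/level_tablesP;
  exists (Some (Some s)).
Qed.

Theorem level_grammar_et0l :
  is_ET0L (fun w => exists tau, gen tau [:: cur k0] w).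
Proof.
exists level_system => w; split=> [[tau kw]|].
  apply: (waiting_steps (tau := tau)) => //.
  by exists w, [::]; rewrite cats0.
by move=> /steps_sem[tau [w1 [_ [-> ? ->]]]]; exists tau; rewrite cats0.
Qed.

End LevelGrammar.

(** * Walkers on an interval *)

(* The integer n is encoded as [nseq n true] if 0 <= n and as
   [nseq (- n) false] otherwise; only constant sequences encode integers. *)
Definition step (z : seq bool) (g : bool) : seq bool :=
  if z is s :: z' then if s == g then g :: z else z' else [:: g].

Lemma step_out (g : bool) z : all (pred1 g) z -> step z g = g :: z.
Proof. by case: z => //= s z /andP[/eqP-> _]; rewrite eqxx. Qed.

Lemma constant_outP z : constant z -> exists s : bool, all (pred1 s) z.
Proof. by case: z => [|s z] /= zs; [exists true|exists s; rewrite /= eqxx]. Qed.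

Lemma all_pred1_neg (s : bool) z : all (pred1 s) z -> count_mem (~~ s) z = 0.
Proof.
by move=> /all_pred1P->; rewrite count_nseq /=; case: s.
Qed.

Lemma all_pred1_count (s : bool) z : all (pred1 s) z -> count_mem s z = size z.
Proof. by rewrite all_count => /eqP. Qed.

Record walker (T : Type) := Walker {
  state :> finType;
  rd : state -> T -> state -> Prop;
  mv : bool -> state -> state -> Prop;
  bn : bool -> state -> state -> Prop
}.

Section Run.
Variables (T : Type) (W : walker T).
Implicit Types (N : bool -> nat) (z : seq bool) (q r p : W) (w : seq T).

(** [N s] is the extent of the interval on the side [s] of 0. A move is checked on its own side
    only, because it cannot increase the distance on the other side. *)
Inductive run N z0 q0 : seq bool -> W -> seq T -> Prop :=
| run_nil : run N z0 q0 z0 q0 [::]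
| run_rd z q w t q' : run N z0 q0 z q w -> rd q t q' ->
    run N z0 q0 z q' (rcons w t)
| run_mv z q w g q' : run N z0 q0 z q w -> mv g q q' ->
    count_mem g (step z g) <= N g -> run N z0 q0 (step z g) q' w
| run_bn z q w s q' : run N z0 q0 z q w -> bn s q q' ->
    z = nseq (N s) s -> run N z0 q0 z q' w.

Lemma run_cat N z0 q0 z1 q1 z2 q2 w1 w2 :
  run N z0 q0 z1 q1 w1 -> run N z1 q1 z2 q2 w2 ->
  run N z0 q0 z2 q2 (w1 ++ w2).
Proof.
move=> r1; elim=> {z2 q2 w2} [|z q w t q' _|z q w g q' _|z q w s q' _].
- by rewrite cats0.
- by rewrite -rcons_cat; apply: run_rd.
- exact: run_mv.
- exact: run_bn.
Qed.

End Run.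

Inductive braid T : seq T -> seq T -> seq T -> Prop :=
| braid_nil : braid [::] [::] [::]
| braid_cat e1 e2 w w1 w2 :
    braid w w1 w2 -> braid (e1 ++ e2 ++ w) (e1 ++ w1) (e2 ++ w2).

(** * The level grammar of a walker and the last-exit decomposition of its runs *)

Section WalkerGrammar.
Variables (T : finType) (W : walker T) (f1 f2 : W).
Implicit Types (N : bool -> nat) (z : seq bool) (q r p : W) (w : seq T).
Implicit Types (s : bool) (c : option bool) (tau : seq (option bool)).

(* The tape labels [None] and [Some s] stand for the cell 0 and for one more cell
   on the side s of 0;
     a nonterminal (c, _) is copied until the label c comes. *)
Definition walker_nt : finType := (option bool * option (bool * W * W))%type.

Local Notation exc c q q' := ((c, Some (false, q, q')) : walker_nt).
Local Notation pair c q q' := ((c, Some (true, q, q')) : walker_nt).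
Local Notation bounce s := ((Some s, None) : walker_nt).
Local Notation cur k := (inr (false, k)).
Local Notation nxt k := (inr (true, k)).

Definition outward c s := if c is Some s' then s' == s else true.

(** An excursion grows at its right end by a letter, a contact with an end, or a full excursion into
    the next cell. A [bounce s] can only be copied, so it survives exactly when no further label
    [Some s] comes. A [pair] follows two walks outward through their last exits. *)
Inductive walker_prod c : walker_nt -> seq (T + bool * walker_nt) -> Prop :=
| walker_copy c' k : c' <> c -> walker_prod c (c', k) [:: nxt (c', k)]
| walker_stop q : walker_prod c (exc c q q) [::]
| walker_rd q r t q' : rd r t q' ->
    walker_prod c (exc c q q') [:: cur (exc c q r); inl t]
| walker_bn q r s q' : outward c s -> bn s r q' ->
    walker_prod c (exc c q q') [:: cur (exc c q r); nxt (bounce s)]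
| walker_mv q r s p p' q' : outward c s -> mv s r p -> mv (~~ s) p' q' ->
    walker_prod c (exc c q q') [:: cur (exc c q r); nxt (exc (Some s) p p')]
| walker_end q1 q2 :
    walker_prod c (pair c q1 q2) [:: cur (exc c q1 f1); cur (exc c q2 f2)]
| walker_pair q1 q2 r1 r2 s p1 p2 : outward c s -> mv s r1 p1 -> mv s r2 p2 ->
    walker_prod c (pair c q1 q2)
      [:: cur (exc c q1 r1); cur (exc c q2 r2); nxt (pair (Some s) p1 p2)].

Lemma size_walker_prod c k f : walker_prod c k f -> size f <= 3.
Proof. by case. Qed.

Definition walker_final (k : walker_nt) := k.2 = None.

Local Notation gen := (gen walker_prod walker_final).

(* tau is the part of the tape that describes the cells beyond z. *)
Definition cell_tape N z tau :=
  forall s, outward (ohead z) s -> count_mem (Some s) tau + size z = N s.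

Definition tape_after c tau := drop (index c tau).+1 tau.

(** Only [bounce] symbols are final, so any other symbol must meet its label: hence [c \in tau]. A
    symbol knows its side of 0 but not its distance, so [z] is quantified and tied to [N] by the
    rest of the tape. *)
Definition walker_sem tau (k : walker_nt) w : Prop :=
  match k with
  | (c, None) => c \notin tau /\ w = [::]
  | (c, Some (b, q, q')) => c \in tau /\
      forall N z, ohead z = c -> constant z ->
        cell_tape N z (tape_after c tau) ->
        if b then exists w1 w2 z', [/\ braid w w1 w2,
            run N z q z' f1 w1 & run N z q' z' f2 w2]
        else run N z q z q' w
  end.

Lemma outward_all z s : constant z -> outward (ohead z) s -> all (pred1 s) z.
Proof. by case: z => //= s' z zs' /eqP<-; rewrite /= eqxx. Qed.

Lemma cell_tape_out N z tau s : constant z -> outward (ohead z) s ->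
  cell_tape N z tau -> Some s \in tau ->
  [/\ step z s = s :: z, constant (s :: z), size z < N s
    & cell_tape N (s :: z) (tape_after (Some s) tau)].
Proof.
move=> zc zs Nz stau; have zs' := outward_all zc zs.
have Ns := Nz s zs.
have ct : count_mem (Some s) tau
    = (count_mem (Some s) (tape_after (Some s) tau)).+1.
  rewrite /tape_after -[in LHS](cat_take_drop (index (Some s) tau) tau).
  rewrite (drop_nth None) ?index_mem // nth_index // count_cat /= eqxx add1n.
  rewrite addnS; congr _.+1; rewrite (_ : count _ _ = 0) //.
  apply/count_memPn; rewrite in_take_leq ?index_size //.
  by rewrite ltnn.
split=> //; first exact: step_out.
  by rewrite -Ns ct addSn ltnS leq_addl.
by move=> s' /eqP<-; rewrite -Ns ct /= addnS.
Qed.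

Lemma tape_after_cons c c' tau : c' <> c ->
  tape_after c (c' :: tau) = tape_after c tau.
Proof. by rewrite /tape_after /= => /eqP/negPf->. Qed.

Lemma tape_after_hd c tau : tape_after c (c :: tau) = tau.
Proof. by rewrite /tape_after /= eqxx drop0. Qed.

Lemma walker_gen_sem tau k w : gen tau [:: cur k] w -> walker_sem tau k w.
Proof.
apply: gen_sem => {tau k w} [[c x] /= E|c tau k f w cf]; first by move: E;
  rewrite /walker_final /= => ->.
case: cf => {k f} /=.
- move=> c' k cc' [w1 [w2 [-> [_ kw1] ->]]]; rewrite cats0.
  have c'c : (c' == c) = false by apply/eqP => c'c; apply: cc'.
  case: k kw1 => [[[b q] q']|] /=; rewrite in_cons c'c //= => -[c'tau sem].
  split=> // N z zc' zC; rewrite tape_after_cons; first exact: sem.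
  by move=> /esym.
- move=> q ->; rewrite mem_head; split=> // N z _ _ _; exact: run_nil.
- move=> q r t q' rtq' [w1 [_ [-> [_ rw] [_ [_ [-> -> ->]]]]]].
  rewrite mem_head; split=> // N z zc zC Nz; rewrite cats1.
  by apply: run_rd rtq'; apply: rw.
- move=> q r s q' cs rq' [w1 [_ [-> [_ rw] [_ [_ [-> [_ [sN ->]] ->]]]]]].
  rewrite !cats0 mem_head; split=> // N z zc zC; rewrite tape_after_hd => Nz.
  apply: run_bn rq' _; first by apply: rw; rewrite ?tape_after_hd.
  have zs : all (pred1 s) z by apply: outward_all; rewrite ?zc.
  by rewrite -Nz ?zc // (count_memPn sN); apply/all_pred1P.
- move=> q r s p p' q' cs rp p'q'.
  case=> w1 [_ [-> [_ rw] [w2 [_ [-> [_ [stau pw]] ->]]]]].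
  rewrite cats0 mem_head; split=> // N z zc zC; rewrite tape_after_hd => Nz.
  rewrite -zc in cs; have [zs szC zN Nsz] := cell_tape_out zC cs Nz stau.
  have z_s := outward_all zC cs.
  apply: (run_cat (z1 := z) (q1 := r)); first by apply: rw;
    rewrite ?tape_after_hd.
  have zE : step (s :: z) (~~ s) = z by rewrite /step; case: (s).
  (* The move back ends at [z], which has no step on the side [~~ s], so its bound is
     [0 <= N (~~ s)]. *)
  rewrite -[X in run _ _ _ X _ _]zE; apply: run_mv p'q' _; last first.
    by rewrite zE all_pred1_neg.
  rewrite -[w2]cat0s; apply: (run_cat (z1 := s :: z) (q1 := p)).
    rewrite -zs; apply: run_mv rp _; first exact: run_nil.
    by rewrite zs /= eqxx all_pred1_count.
  exact: pw.
- move=> q1 q2 [w1 [_ [-> [_ q1w] [w2 [_ [-> [_ q2w] ->]]]]]].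
  rewrite mem_head; split=> // N z zc zC Nz; exists w1, w2, z.
  split; [|exact: q1w|exact: q2w].
  rewrite -[X in braid _ X _]cats0 -[X in braid _ _ X]cats0.
  by constructor; constructor.
- move=> q1 q2 r1 r2 s p1 p2 cs rp1 rp2.
  case=> e1 [_ [-> [_ q1w] [e2 [_ [-> [_ q2w] [w3 [_ [-> [_ [stau pw]] ->]]]]]]]].
  rewrite cats0 mem_head; split=> // N z zc zC; rewrite tape_after_hd => Nz.
  rewrite -zc in cs; have [zs szC zN Nsz] := cell_tape_out zC cs Nz stau.
  have z_s := outward_all zC cs.
  have [w1 [w2 [z' [w12 r1w r2w]]]] := pw N (s :: z) erefl szC Nsz.
  have go q r p e w0 : (forall N z, ohead z = c -> constant z ->
        cell_tape N z (tape_after c (c :: tau)) -> run N z q z r e) ->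
      mv s r p -> forall f, run N (s :: z) p z' f w0 -> run N z q z' f (e ++ w0).
    move=> qr rp f pf; apply: run_cat pf; rewrite -zs.
    apply: run_mv rp _; first by apply: qr; rewrite ?tape_after_hd.
    by rewrite zs /= eqxx all_pred1_count.
  exists (e1 ++ w1), (e2 ++ w2), z'; split; first exact: braid_cat.
    exact: go q1w rp1 _ r1w.
  exact: go q2w rp2 _ r2w.
Qed.

(** All fitting tapes are allowed: the labels of the two sides may interleave in any way, and only
    their numbers matter. *)
Definition derives N z (x : option (bool * W * W)) w :=
  forall tau, cell_tape N z tau -> gen (ohead z :: tau) [:: cur (ohead z, x)] w.

Lemma gen_prod c tau k f w :
  walker_prod c k f -> gen (c :: tau) f w -> gen (c :: tau) [:: cur k] w.
Proof. by move=> kf fw; rewrite -[w]cats0; apply: gen_cur kf fw _;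
  constructor. Qed.

Lemma gen_copy c c' tau x w :
  c' <> c -> gen tau [:: cur (c', x)] w -> gen (c :: tau) [:: cur (c', x)] w.
Proof.
move=> cc' xw; apply: gen_prod (walker_copy _ cc') _.
by rewrite -[w]cats0; apply: gen_nxt xw _; constructor.
Qed.

Lemma gen_bounce tau s : count_mem (Some s) tau = 0 ->
  gen tau [:: cur (bounce s)] [::].
Proof.
elim: tau => [_|c tau IH] /=; first by apply: gen_final => //; constructor.
case: eqP => //= cs /IH; apply: gen_copy => sc; exact: cs.
Qed.

(** Other labels are skipped by copying until the first [Some s], whose existence follows from
    [size z < N s]. *)
Lemma derives_nxt N z s x w tau :
  outward (ohead z) s -> size z < N s -> cell_tape N z tau ->
  derives N (s :: z) x w -> gen tau [:: cur (Some s, x)] w.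
Proof.
move=> zs zN /(_ _ zs) Ns xw; elim: tau Ns => [Ns|c tau IH] /=.
  by rewrite -Ns ltnn in zN.
case: eqP => [->|cs] /= Ns; last by apply: gen_copy (IH Ns) => sc; apply: cs.
by apply: xw => s' /eqP<-; rewrite -Ns addnS add1n addSn.
Qed.

Lemma derives_stop N z q : derives N z (Some (false, q, q)) [::].
Proof. by move=> tau _; apply: gen_prod (walker_stop _ _) _; constructor. Qed.

Lemma derives_rd N z q r w t q' : derives N z (Some (false, q, r)) w ->
  rd r t q' -> derives N z (Some (false, q, q')) (rcons w t).
Proof.
move=> qw rq' tau Nz; apply: gen_prod (walker_rd _ _ rq') _.
rewrite -cats1; apply: (gen_cat (f := [:: _])); first exact: qw.
by constructor; constructor.
Qed.

Lemma derives_bn N z q r w s q' : derives N z (Some (false, q, r)) w ->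
  bn s r q' -> z = nseq (N s) s -> derives N z (Some (false, q, q')) w.
Proof.
move=> qw rq' zN tau Nz.
have zs : outward (ohead z) s by rewrite zN; case: (N s) => /=.
apply: gen_prod (walker_bn _ zs rq') _.
rewrite -[w]cats0; apply: (gen_cat (f := [:: _])); first exact: qw.
apply: (gen_nxt (w1 := [::])); last by constructor.
apply: gen_bounce; apply/eqP; rewrite -(eqn_add2r (size z)) Nz //.
by rewrite zN size_nseq.
Qed.

Lemma derives_mv N z q r w s p p' q' w' : derives N z (Some (false, q, r)) w ->
  outward (ohead z) s -> size z < N s -> mv s r p ->
  derives N (s :: z) (Some (false, p, p')) w' -> mv (~~ s) p' q' ->
  derives N z (Some (false, q, q')) (w ++ w').
Proof.
move=> qw zs zN rp pw p'q' tau Nz; apply: gen_prod (walker_mv _ zs rp p'q') _.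
apply: (gen_cat (f := [:: _])); first exact: qw.
rewrite -[w']cats0; apply: gen_nxt; last by constructor.
exact: derives_nxt pw.
Qed.

(* Last-exit decomposition of a run starting at the root [::]. *)
Inductive chain N q0 : seq bool -> W -> seq T -> Prop :=
| chain_root q w :
    derives N [::] (Some (false, q0, q)) w -> chain N q0 [::] q w
| chain_out s z r p q w w' : chain N q0 z r w -> all (pred1 s) z ->
    size z < N s -> mv s r p -> derives N (s :: z) (Some (false, p, q)) w' ->
    chain N q0 (s :: z) q (w ++ w').

(** An event that leaves the position at [z] changes only the last piece of the decomposition. The
    hypothesis is uniform in [p] because the state in which that piece starts is hidden in the
    chain. *)
Lemma chain_extend N q0 z r w q w' : chain N q0 z r w ->
  (forall p u, derives N z (Some (false, p, r)) u ->
               derives N z (Some (false, p, q)) (u ++ w')) ->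
  chain N q0 z q (w ++ w').
Proof.
case=> {z r w} [r w q0w /(_ _ _ q0w)|s z r p q' w w1 ch zs zN rp pw].
  exact: chain_root.
by move/(_ _ _ pw); rewrite -catA; apply: chain_out rp.
Qed.

Lemma all_outward z s : all (pred1 s) z -> outward (ohead z) s.
Proof. by case: z => //= s' z /andP[/eqP->]. Qed.

Lemma run_chain N q0 z q w : run N [::] q0 z q w -> constant z /\ chain N q0 z q w.
Proof.
elim=> {z q w} [|z q w t q' _ [zc IH] qq'|z q w g q' _ [zc IH] qq' zN|].
- by split=> //; apply: chain_root; apply: derives_stop.
- split=> //; rewrite -cats1; apply: chain_extend IH _ => p u pu.
  by rewrite cats1; apply: derives_rd qq'.
- have [zg|gz] := boolP (all (pred1 g) z).
    rewrite step_out //; split=> //; rewrite -[w]cats0.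
    apply: (chain_out IH zg _ qq'); last exact: derives_stop.
    by move: zN; rewrite step_out //= eqxx all_pred1_count.
  (* An inward move closes the last piece: with the move out and the move back it becomes one
     excursion of the previous cell. *)
  case: IH qq' gz zc zN => {z q w} // s z r p q1 w w' ch zs zN rp pw qq'.
  move=> gz _ _; have sg : s != g by apply: contra gz => /eqP<-;
    rewrite /= eqxx.
  rewrite /= (negPf sg); have {}sg : s = ~~ g by case: (s) (g) sg => -[].
  split; first by case: (z) zs => //= s' z' /andP[/eqP->].
  apply: chain_extend ch _ => p' u pu.
  apply: derives_mv (all_outward zs) zN rp pw _ => //.
  by rewrite sg negbK.
- move=> z q w s q' _ [zc IH] qq' zN; split=> //.
  rewrite -[w]cats0; apply: chain_extend IH _ => p u pu.
  by rewrite cats0; apply: derives_bn qq' zN.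
Qed.

(** Both chains end at the same position, so they have one piece per cell up to it, and the pieces
    are paired cell by cell. *)
Lemma derives_pair N q1 q2 z u1 u2 : chain N q1 z f1 u1 -> chain N q2 z f2 u2 ->
  exists2 w, derives N [::] (Some (true, q1, q2)) w & braid w u1 u2.
Proof.
(* [w] already braids the parts of both walks beyond [z], and any two pieces in the cell [z] can be
   put in front of it. The induction proceeds from the common end point in towards 0. *)
pose tail z r1 r2 w w1 w2 := forall p1 p2 e1 e2,
  derives N z (Some (false, p1, r1)) e1 ->
  derives N z (Some (false, p2, r2)) e2 ->
  derives N z (Some (true, p1, p2)) (e1 ++ e2 ++ w) /\
  braid (e1 ++ e2 ++ w) (e1 ++ w1) (e2 ++ w2).
suff main z' r1 r2 v1 v2 w w1 w2 : chain N q1 z' r1 v1 -> chain N q2 z' r2 v2 ->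
    tail z' r1 r2 w w1 w2 ->
    exists2 w', derives N [::] (Some (true, q1, q2)) w' &
                braid w' (v1 ++ w1) (v2 ++ w2).
  move=> ch1 ch2; rewrite -[u1]cats0 -[u2]cats0; apply: main ch1 ch2 _.
  move=> p1 p2 e1 e2 pe1 pe2; split; last by do 2!constructor.
  move=> tau Nz; apply: gen_prod (walker_end _ _ _) _.
  rewrite cats0; apply: (gen_cat (f := [:: _])); first exact: pe1.
  exact: pe2.
elim: z' r1 r2 v1 v2 w w1 w2 => [|s z' IH] r1 r2 v1 v2 w w1 w2 ch1 ch2 tl.
  inversion ch1 as [? ? q1v|]; inversion ch2 as [? ? q2v|]; subst.
  by have [? ?] := tl _ _ _ _ q1v q2v; exists (v1 ++ v2 ++ w).
inversion ch1 as [|? ? r1' p1 ? v1' e1 ch1' zs zN rp1 pe1]; subst.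
inversion ch2 as [|? ? r2' p2 ? v2' e2 ch2' _ _ rp2 pe2]; subst.
have [pw br] := tl _ _ _ _ pe1 pe2.
rewrite -!catA;
  apply: (IH _ _ _ _ (e1 ++ e2 ++ w) _ _ ch1' ch2') => p1' p2' e1' e2' pe1' pe2'.
split; last exact: (braid_cat _ _ br).
move=> tau Nz; apply: gen_prod (walker_pair _ _ (all_outward zs) rp1 rp2) _.
apply: (gen_cat (f := [:: _])); first exact: pe1'.
apply: (gen_cat (f := [:: _])); first exact: pe2'.
rewrite -[e1 ++ e2 ++ w]cats0.
apply: gen_nxt; last by constructor.
exact: derives_nxt (all_outward zs) zN Nz pw.
Qed.

Lemma derives_gen N x w : derives N [::] x w ->
  exists tau, gen tau [:: cur (None, x)] w.
Proof.
move=> xw;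
  (* The leading [None] is the cell 0; the order of the other labels is free. *)
  exists (None :: nseq (N true) (Some true) ++ nseq (N false) (Some false)).
apply: xw => s _; rewrite addn0 count_cat !count_nseq /=.
by case: s; rewrite /= ?mul1n ?mul0n ?addn0.
Qed.

Lemma walker_sem_root tau b q q' w : walker_sem tau (None, Some (b, q, q')) w ->
  exists N, if b then exists w1 w2 z', [/\ braid w w1 w2,
      run N [::] q z' f1 w1 & run N [::] q' z' f2 w2]
    else run N [::] q [::] q' w.
Proof.
move=> [_ sem]; exists (fun s => count_mem (Some s) (tape_after None tau)).
by apply: sem => // s _; rewrite addn0.
Qed.

Theorem closed_run_et0l :
  is_ET0L (fun w => exists N, run N [::] f1 [::] f2 w).
Proof.
have [G GP] := level_grammar_et0l walker_final (exc None f1 f2) size_walker_prod.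
exists G => w; rewrite -GP; split=> [[N /run_chain[_ ch]]|[tau]].
  by inversion ch as [? ? qw|]; subst; apply: derives_gen qw.
by move=> /walker_gen_sem/walker_sem_root.
Qed.

(** Two words have many braids, and the grammar yields only some of them; so [L] is described by
    soundness for each of its words and by the existence of one braid for each pair of runs. *)
Theorem run_pair_et0l q q' : exists2 L, is_ET0L L &
  (forall w, L w -> exists N z w1 w2,
     [/\ run N [::] q z f1 w1, run N [::] q' z f2 w2 & braid w w1 w2]) /\
  (forall N z w1 w2, run N [::] q z f1 w1 -> run N [::] q' z f2 w2 ->
     exists2 w, L w & braid w w1 w2).
Proof.
have GP := level_grammar_et0l walker_final (pair None q q') size_walker_prod.
exists (fun w => exists tau, gen tau [:: cur (pair None q q')] w) => //.
split=> [w [tau /walker_gen_sem/walker_sem_root[N [w1 [w2 [z [br qw q'w]]]]]]|].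
  by exists N, z, w1, w2.
move=> N z w1 w2 /run_chain[_ ch1] /run_chain[_ ch2].
have [w qw br] := derives_pair ch1 ch2.
by exists w => //; apply: derives_gen qw.
Qed.

End WalkerGrammar.

(** * Two runs of a walker as runs of one walker *)

Section Twin.
Variables (T1 T : Type) (W : walker T1) (enc : bool -> T1 -> T) (sep : T -> Prop).
Variables (q0 qf : W).

(* Runs W twice, on the letters [enc false a] and then, after a separator read
   in state qf, from q0 on the letters [enc true a]. *)
Definition twin : walker T := @Walker T (W * bool)%type
  (fun x t y => (x.2 = y.2 /\ exists2 a, t = enc x.2 a & rd x.1 a y.1) \/
     [/\ sep t, x = (qf, false) & y = (q0, true)])
  (fun g x y => x.2 = y.2 /\ mv g x.1 y.1)
  (fun s x y => x.2 = y.2 /\ bn s x.1 y.1).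

Lemma twin_run N z0 q z q' m u : run (W := W) N z0 q z q' u ->
  run (W := twin) N z0 (q, m) z (q', m) (map (enc m) u).
Proof.
elim=> {z q' u} [|z r w t r' _ IH rr'|z r w g r' _ IH rr'|z r w s r' _ IH rr'].
- exact: run_nil.
- by rewrite map_rcons; apply: run_rd IH _; left; split=> //; exists t.
- by apply: run_mv IH _.
- by apply: run_bn IH _.
Qed.

(** The flag in the state never returns from [true] to [false], so at most one separator is read. *)
Lemma twin_run_inv N z0 x z y w : run (W := twin) N z0 x z y w ->
  (x.2 = y.2 /\ exists2 u, w = map (enc x.2) u & run N z0 x.1 z y.1 u) \/
  [/\ x.2 = false, y.2 = true & exists u h v z1,
     [/\ w = map (enc false) u ++ h :: map (enc true) v, sep h,
         run N z0 x.1 z1 qf u & run N z1 q0 z y.1 v]].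
Proof.
elim=> {z y w} [|z y w t y' _ IH|z y w g y' _ IH [<- yy'] zN|z y w s y' _ IH].
- by left; split=> //; exists [::] => //; apply: run_nil.
- case=> [[<- [a -> yy']]|[tsep yE ->]].
    case: IH => [[xy [u -> xu]]|[x2 y2 [u [h [v [z1 [-> hs xu yv]]]]]]].
      left; split=> //; exists (rcons u a); first by rewrite map_rcons xy.
      exact: run_rd yy'.
    right; split=> //; exists u, h, (rcons v a), z1.
    by split=> //; [rewrite rcons_cat map_rcons y2|apply: run_rd yy'].
  case: IH => [[xy [u -> xu]]|[_]]; last by rewrite yE.
  rewrite xy yE in xu *; right; split=> //; exists u, t, [::], z.
  by rewrite cats1; split=> //; apply: run_nil.
- case: IH => [[xy [u -> xu]]|[x2 y2 [u [h [v [z1 [-> hs xu yv]]]]]]].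
    by left; split=> //; exists u => //; apply: run_mv yy' _.
  by right; split=> //; exists u, h, v, z1; split=> //; apply: run_mv yy' _.
- move=> [<- yy'] zN.
  case: IH => [[xy [u -> xu]]|[x2 y2 [u [h [v [z1 [-> hs xu yv]]]]]]].
    by left; split=> //; exists u => //; apply: run_bn yy' zN.
  by right; split=> //; exists u, h, v, z1; split=> //; apply: run_bn yy' zN.
Qed.

End Twin.

(** * Separated runs and paired runs are ET0L *)

Section Languages.
Variables (T : finType) (W : walker T) (q0 qf : W).

(** A closed run of the twin walker is a run from 0 to some [z] and, after the separator, a run from
    [z] back to 0. *)
Theorem separated_runs_et0l : is_ET0L (fun w => exists N z u v,
  [/\ w = map Some u ++ None :: map Some v,
      run N [::] q0 z qf u & run N z q0 [::] qf v]).
Proof.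
pose W2 := twin (fun _ => @Some T) (fun t => t = None) q0 qf.
have [G GP] := closed_run_et0l (W := W2) (q0, false) (qf, true).
exists G => w; rewrite -GP; split=> [[N [z [u [v [-> ru rv]]]]]|[N]].
  exists N; rewrite -cat_rcons.
  apply: run_cat (twin_run (fun _ => @Some T) (fun t => t = None) q0 qf true rv).
  apply: run_rd (twin_run _ _ _ _ false ru) _.
  by right.
move=> /twin_run_inv[[//]|[_ _ [u [h [v [z [-> -> ru rv]]]]]]].
by exists N, z, u, v.
Qed.

Lemma tape1_cat A (u v : seq (A + A)) : tape1 (u ++ v) = tape1 u ++ tape1 v.
Proof. exact: pmap_cat. Qed.

Lemma tape2_cat A (u v : seq (A + A)) : tape2 (u ++ v) = tape2 u ++ tape2 v.
Proof. exact: pmap_cat. Qed.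

Lemma map_catP A B (f : A -> B) e w u :
  e ++ w = map f u -> exists u1 u2, [/\ u = u1 ++ u2, e = map f u1 & w = map f u2].
Proof.
move=> E; exists (take (size e) u), (drop (size e) u).
by rewrite cat_take_drop map_take map_drop -E take_size_cat ?drop_size_cat.
Qed.

Lemma braid_tapes A (w : seq (A + A)) u v : braid w (map inl u) (map inr v) ->
  tape1 w = u /\ tape2 w = v.
Proof.
move Eu: (map inl u) => u'; move Ev: (map inr v) => v' br.
elim: br u v Eu Ev => {w u' v'} [[|//] [|//] _ _ //|e1 e2 w w1 w2 _ IH u v].
move=> /esym/map_catP[u1 [u2 [-> -> w1E]]] /esym/map_catP[v1 [v2 [-> -> w2E]]].
have [w1' w2'] := IH u2 v2 (esym w1E) (esym w2E).
have t1l (x : seq A) : tape1 (map inl x) = x by elim: x => //= ? ? ->.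
have t1r (x : seq A) : tape1 (map inr x) = [::] by elim: x => //= ? ? ->.
have t2l (x : seq A) : tape2 (map inl x) = [::] by elim: x => //= ? ? ->.
have t2r (x : seq A) : tape2 (map inr x) = x by elim: x => //= ? ? ->.
by rewrite !tape1_cat !tape2_cat t1l t1r t2l t2r w1' w2'.
Qed.

(** Without separators the flag is constant and only colours the letters by tape. The tapes of a
    braid are then the two words, however they were cut. *)
Theorem paired_runs_et0l : is_ET0L_rel (fun u v => exists N z,
  run N [::] q0 z qf u /\ run N [::] q0 z qf v).
Proof.
pose W2 := twin (fun m : bool => if m then @inr T T else @inl T T)
  (fun=> False) q0 qf.
have [L LE [Ls Lc]] := run_pair_et0l (W := W2) (qf, false) (qf, true)
  (q0, false) (q0, true).
exists L => // u v; split=> [[N [z [ru rv]]]|[w Lw [-> ->]]].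
  have [w Lw] := Lc N z _ _ (twin_run _ _ _ _ false ru) (twin_run _ _ _ _ true rv).
  by move=> /braid_tapes[t1 t2]; exists w.
have [N [z [w1 [w2 []]]]] := Ls w Lw.
move=> /twin_run_inv[[_ [u' -> ru]]|[_ //]].
move=> /twin_run_inv[[_ [v' -> rv]]|[//]].
by move=> /braid_tapes[-> ->]; exists N, z.
Qed.

End Languages.

(** * Walks on the integers and the free inverse monoid of rank 1 *)

Definition walk_end : seq bool -> seq bool -> seq bool := foldl step.

Fixpoint trace z w : seq (seq bool) :=
  z :: if w is g :: w' then trace (step z g) w' else [::].

Lemma trace_cons z g w : trace z (g :: w) = z :: trace (step z g) w.
Proof. by []. Qed.

Definition flip (w : seq bool) := rev (map negb w).

Lemma flip_cons g w : flip (g :: w) = rcons (flip w) (~~ g).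
Proof. by rewrite /flip /= rev_cons. Qed.

Lemma flip_cat u v : flip (u ++ v) = flip v ++ flip u.
Proof. by rewrite /flip map_cat rev_cat. Qed.

Lemma mem_trace_start z w : z \in trace z w.
Proof. by case: w => *; rewrite mem_head. Qed.

Lemma mem_trace_cat z u v : trace z (u ++ v) =i
  [predU trace z u & trace (walk_end z u) v].
Proof.
elim: u z => [|g u IH] z y.
  by rewrite !inE orb_idl // => /eqP->; apply: mem_trace_start.
by rewrite cat_cons !trace_cons !inE IH !inE orbA.
Qed.

Lemma mem_trace_end z w : walk_end z w \in trace z w.
Proof. by elim: w z => [|g w IH] z; rewrite inE ?eqxx // IH orbT. Qed.

Lemma mem_trace_rcons z w g : trace z (rcons w g) =i
  rcons (trace z w) (walk_end z (rcons w g)).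
Proof.
move=> y; rewrite mem_rcons -cats1 mem_trace_cat trace_cons !inE.
rewrite /walk_end foldl_cat orbA orbC; congr (_ || _).
by rewrite orb_idr // => /eqP->; apply: mem_trace_end.
Qed.

Lemma constant_step z g : constant z -> constant (step z g).
Proof.
case: z => //= s z; case: eqP => [->|_] //= zs; first by rewrite eqxx zs.
by case: z zs => //= s' z /andP[/eqP->].
Qed.

Lemma step_flip z g : constant z -> step (step z g) (~~ g) = z.
Proof.
case: z => [|s z] /=; first by case: g.
case: eqP => [->|/eqP sg] zs; first by case: (g).
have {sg}sg : ~~ g = s by case: (s) (g) sg => -[].
by rewrite sg step_out.
Qed.

Lemma constant_walk_end z w : constant z -> constant (walk_end z w).
Proof. by elim: w z => //= g w IH z zc; apply/IH/constant_step. Qed.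

Lemma constant_trace z w y : constant z -> y \in trace z w -> constant y.
Proof.
elim: w z => [|g w IH] z zc; first by rewrite inE => /eqP->.
by rewrite trace_cons inE => /predU1P[-> //|]; apply/IH/constant_step.
Qed.

(** The formal inverse undoes the steps in reverse order, hence revisits the same positions. *)
Lemma walk_flip z w : constant z ->
  walk_end (walk_end z w) (flip w) = z /\
  trace (walk_end z w) (flip w) =i trace z w.
Proof.
elim: w z => [|g w IH] z zc //=; have [E tE] := IH _ (constant_step g zc).
rewrite flip_cons; split=> [|y].
  by rewrite /walk_end foldl_rcons /= -/walk_end E step_flip.
rewrite mem_trace_rcons mem_rcons !inE tE.
by rewrite /walk_end foldl_rcons /= -/walk_end E step_flip.
Qed.

Definition letter (b : bool) : 'I_1 + 'I_1 := if b then inl ord0 else inr ord0.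
Definition dir (a : 'I_1 + 'I_1) : bool := if a is inl _ then true else false.

Lemma dirK : cancel dir letter.
Proof. by case=> i; rewrite (ord1 i). Qed.

Lemma dir_winv w : map dir (winv w) = flip (map dir w).
Proof.
by rewrite /flip /winv map_rev -!map_comp; congr rev; apply: eq_map => -[].
Qed.

(** End point and set of visited positions are invariants of the congruence. The start is arbitrary
    so that the second factor of a product can be walked from the end of the first. *)
Lemma fim_cong_trace u v : fim_cong u v -> forall z, constant z ->
  walk_end z (map dir u) = walk_end z (map dir v) /\
  trace z (map dir u) =i trace z (map dir v).
Proof.
have we z a b : walk_end z (a ++ b) = walk_end (walk_end z a) b.
  exact: foldl_cat.
elim=> {u v} [//|u v _ IH|v u w _ IH1 _ IH2|u u' v v' _ IH1 _ IH2|u|u v] z zc.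
- by have [-> uv] := IH z zc; split=> // y; rewrite uv.
- have [-> uv] := IH1 z zc; have [-> vw] := IH2 z zc.
  by split=> // y; rewrite uv.
- have [uE uu'] := IH1 z zc.
  have [vE vv'] := IH2 _ (constant_walk_end (map dir u') zc).
  rewrite !map_cat !we uE; split=> // y.
  by rewrite !mem_trace_cat !inE uE uu' vv'.
- rewrite !map_cat dir_winv !we; have [-> uf] := walk_flip (map dir u) zc.
  split=> // y; rewrite !(mem_trace_cat, inE) uf.
  by have [-> _] := walk_flip (map dir u) zc; rewrite !orbb.
have [uE uf] := walk_flip (map dir u) zc;
  have [vE vf] := walk_flip (map dir v) zc.
rewrite !map_cat !dir_winv !we !(uE, vE); split=> // y.
by rewrite !(mem_trace_cat, inE, uE, vE, uf, vf) !orbb; case: (y \in _);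
  case: (y \in _).
Qed.

(** * Munn's normal form in rank one *)

Section Munn.
Local Open Scope group_scope.
Implicit Types (z w : seq bool) (N : bool -> nat).

Definition fimw w : FIM_ 1 := fim_class (map letter w).

Lemma fimw_cat u v : fimw (u ++ v) = fimw u * fimw v.
Proof. by rewrite /fimw map_cat /mul /= fim_mulE. Qed.

Lemma fimw_neg b : fimw [:: ~~ b] = (fimw [:: b])^-1.
Proof. by rewrite /fimw /inv /= fim_invE; case: b. Qed.

(** The integer [n] stands for the power [x^n] of the generator; the reversal makes a step outward a
    multiplication on the right. *)
Definition at_pos z : FIM_ 1 := fimw (rev z).
Definition idem z := at_pos z * (at_pos z)^-1.

Lemma at_pos_cons s z : at_pos (s :: z) = at_pos z * fimw [:: s].
Proof. by rewrite /at_pos rev_cons -cats1 fimw_cat. Qed.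

Lemma idemM z : idem z * idem z = idem z.
Proof. by rewrite /idem mulgA fim_mulVK. Qed.

Lemma idemC y z : idem y * idem z = idem z * idem y.
Proof. exact: fim_mulVC. Qed.

Lemma idem_at_pos z : idem z * at_pos z = at_pos z.
Proof. exact: fim_mulVK. Qed.

Lemma idem_cons s z : idem z * idem (s :: z) = idem (s :: z).
Proof. by rewrite {2 3}/idem at_pos_cons !mulgA idem_at_pos. Qed.

Lemma at_pos_step z g : constant z ->
  at_pos z * fimw [:: g] = idem z * at_pos (step z g).
Proof.
move=> zc; have [zg|gz] := boolP (all (pred1 g) z).
  by rewrite step_out // at_pos_cons mulgA idem_at_pos.
case: z zc gz => //= s z zc; case: eqP => [<-|/eqP sg _]; first by rewrite zc.
have {sg} -> : g = ~~ s by case: (s) (g) sg => -[].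
rewrite fimw_neg /idem at_pos_cons fim_invM.
have := fim_mulVC (fimw [:: s]) (at_pos z)^-1; rewrite fim_invK => C.
by rewrite -!mulgA [fimw [:: s] * (_ * (_ * _))]mulgA C !mulgA fim_mulVK.
Qed.

(** Munn's normal form: each step leaves the idempotent of the position it starts from, which is
    pushed to the left. *)
Lemma at_pos_trace z w : constant z ->
  at_pos z * fimw w = \prod_(y <- trace z w) idem y * at_pos (walk_end z w).
Proof.
elim: w z => [|g w IH] z zc.
  by rewrite big_seq1 idem_at_pos /fimw /= mulg1.
rewrite trace_cons big_cons -cat1s fimw_cat mulgA at_pos_step //.
by rewrite -!mulgA IH //; apply: constant_step.
Qed.

Lemma fimw_trace w :
  fimw w = \prod_(y <- trace [::] w) idem y * at_pos (walk_end [::] w).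
Proof. by rewrite -at_pos_trace // /at_pos /fimw /= mul1g. Qed.

Definition spans N z w :=
  (forall y s, y \in trace z w -> count_mem s y <= N s) /\
  (forall s, nseq (N s) s \in trace z w).

(** The extra [[::]] covers a list with no position on the side [s], whose level is 0. *)
Lemma max_level s (l : seq (seq bool)) : all (@constant _) l ->
  exists2 n, all (fun y => count_mem s y <= n) l & nseq n s \in [::] :: l.
Proof.
elim: l => [|y l IH] /=; first by exists 0.
case/andP=> yc /IH[n ln nl].
case: (leqP (count_mem s y) n) => [yn|ny].
  by exists n; rewrite ?yn //; move: nl; rewrite !inE => /orP[->|->];
    rewrite ?orbT.
exists (count_mem s y).
  by rewrite leqnn; apply: sub_all ln => x /leq_trans; apply; apply: ltnW.
have /constant_outP[s' ys'] := yc; rewrite !inE; apply/orP; right.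
have -> : s = s'; last by rewrite all_pred1_count // -(all_pred1P _ _ ys') eqxx.
apply/eqP; apply: contraLR ny => ss'; rewrite -leqNgt.
have {ss'} -> : s = ~~ s' by case: (s) (s') ss' => -[].
by rewrite all_pred1_neg.
Qed.

Lemma spans_exists w : exists N, spans N [::] w.
Proof.
have tc : all (@constant _) (trace [::] w).
  by apply/allP => y; apply: constant_trace.
have t0 : {subset [::] :: trace [::] w <= trace [::] w}.
  by move=> y; rewrite inE => /predU1P[->|//]; apply: mem_trace_start.
have [n1 n1P n1t] := max_level true tc; have [n2 n2P n2t] := max_level false tc.
exists (fun s => if s then n1 else n2); split; last by case; apply: t0.
by move=> y [] yt; [apply: (allP n1P)|apply: (allP n2P)].
Qed.

Lemma idem_nseq s m n : m <= n ->
  idem (nseq m s) * idem (nseq n s) = idem (nseq n s).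
Proof.
move/subnK<-; elim: (n - m) => [|k IH] /=; first exact: idemM.
by rewrite -idem_cons mulgA IH.
Qed.

Lemma idem_prodC y l :
  idem y * (\prod_(z <- l) idem z) = (\prod_(z <- l) idem z) * idem y.
Proof.
elim: l => [|z l IH]; first by rewrite big_nil mulg1 mul1g.
by rewrite big_cons mulgA idemC -mulgA IH mulgA.
Qed.

Lemma idem_prod y l : y \in l ->
  idem y * (\prod_(z <- l) idem z) = \prod_(z <- l) idem z.
Proof.
elim: l => //= z l IH; rewrite inE big_cons => /predU1P[->|/IH yl].
  by rewrite mulgA idemM.
by rewrite mulgA idemC -mulgA yl.
Qed.

(** The idempotents decrease away from 0, so those of the two end points absorb all the others; both
    end points are visited, so they are themselves absorbed by the product. *)
Lemma spans_prod N w : spans N [::] w ->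
  \prod_(y <- trace [::] w) idem y =
  idem (nseq (N true) true) * idem (nseq (N false) false).
Proof.
move=> [le_N in_tr]; set F := RHS.
have FE : F * \prod_(y <- trace [::] w) idem y = \prod_(y <- trace [::] w) idem y.
  by rewrite /F -mulgA !idem_prod.
have EF l : (forall y, y \in l -> constant y /\ forall s, count_mem s y <= N s) ->
    (\prod_(y <- l) idem y) * F = F.
  elim: l => [|y l IH] ly; first by rewrite big_nil mul1g.
  rewrite big_cons -mulgA IH => [|z zl]; last by apply: ly; rewrite inE zl orbT.
  have [/constant_outP[s ys] yN] := ly y (mem_head _ _).
  have := yN s; rewrite all_pred1_count // => /(idem_nseq s).
  rewrite -(all_pred1P _ _ ys) /F => yF; case: s {ys} yF => yF.
    by rewrite mulgA yF.
  by rewrite mulgA (idemC y) -mulgA yF.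
have FC : F * \prod_(y <- trace [::] w) idem y =
    (\prod_(y <- trace [::] w) idem y) * F.
  by rewrite /F -mulgA idem_prodC mulgA idem_prodC -mulgA.
rewrite -FE FC EF // => y yt; split; last by move=> s; apply: le_N.
exact: constant_trace yt.
Qed.

(** Munn's theorem in rank one: the set of visited positions enters only through the two extents in
    [N]. *)
Lemma fim_class_eq (u v : sword 'I_1) : fim_class u = fim_class v <->
  exists N, [/\ spans N [::] (map dir u), spans N [::] (map dir v)
    & walk_end [::] (map dir u) = walk_end [::] (map dir v)].
Proof.
split=> [/fim_classP/fim_cong_trace/(_ [::] erefl)[uvE uv]|[N [uN vN uvE]]].
  have [N uN] := spans_exists (map dir u); exists N; split=> //.
  case: uN => le_N in_tr.
  by split=> [y s|s]; rewrite -uv; [apply: le_N|apply: in_tr].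
have fimwE (w : sword 'I_1) : fim_class w = fimw (map dir w).
  by rewrite /fimw -map_comp (eq_map dirK) map_id.
by rewrite !fimwE !fimw_trace (spans_prod uN) (spans_prod vN) uvE.
Qed.

End Munn.

(** * Evaluating words by a walker *)

Section Reader.
Variables (T : finType) (lw : T -> seq bool).

Let m := \max_(t : T) size (lw t).

Definition expand (u : seq T) := flatten (map lw u).

(* The state is the part of the last letter not yet walked along, and the set
   of ends of the interval already touched. *)
Definition reader : walker T := @Walker T (m.-bseq bool * {set bool})%type
  (fun x t y => [/\ x.1 = [::] :> seq bool, y.1 = lw t :> seq bool & y.2 = x.2])
  (fun g x y => x.1 = g :: y.1 :> seq bool /\ y.2 = x.2)
  (fun s x y => x.1 = y.1 /\ y.2 = s |: x.2).

Definition reader0 : reader := ([bseq], set0).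
Definition readerT : reader := ([bseq], setT).

Implicit Types (N : bool -> nat) (z w : seq bool) (u : seq T).

Lemma expand_cat u v : expand (u ++ v) = expand u ++ expand v.
Proof. by rewrite /expand map_cat flatten_cat. Qed.

Lemma expand_rcons u t : expand (rcons u t) = expand u ++ lw t.
Proof. by rewrite /expand map_rcons flatten_rcons. Qed.

Lemma count_step s z g : s != g -> count_mem s (step z g) <= count_mem s z.
Proof.
move=> sg; have gs : (g == s) = false by rewrite eq_sym (negPf sg).
case: z => [|s' z] /=; first by rewrite gs.
by case: eqP => [->|_] //=; [rewrite gs leq_addl|apply: leq_addl].
Qed.

(** The witness [w] is the part already walked; what the state still holds is the rest of the last
    letter read. *)
Lemma reader_sound N z0 z q u : (forall s, count_mem s z0 <= N s) ->
  run (W := reader) N z0 reader0 z q u ->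
  exists w, [/\ expand u = w ++ q.1, z = walk_end z0 w,
    forall y s, y \in trace z0 w -> count_mem s y <= N s &
    forall s, s \in q.2 -> nseq (N s) s \in trace z0 w].
Proof.
move=> z0N; elim=> {z q u} [|z q u t q' _ [w [uE zE wN qw]] [qE q'E q'q]||].
- exists [::]; split=> // [y s|s]; last by rewrite inE.
  by rewrite inE => /eqP->.
- exists w; split=> //; last by rewrite q'q.
  by rewrite expand_rcons uE qE q'E cats0.
- move=> z q u g q' _ [w [uE zE wN qw]] [qE q'q] zN; exists (rcons w g); split.
  + by rewrite uE qE cat_rcons.
  + by rewrite zE /walk_end foldl_rcons.
  + move=> y s; rewrite mem_trace_rcons mem_rcons inE => /predU1P[->|];
      last exact: wN.
    rewrite /walk_end foldl_rcons -/walk_end -zE.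
    have [->|sg] := eqVneq s g; first exact: zN.
    by apply: leq_trans (count_step _ sg) _; rewrite zE wN ?mem_trace_end.
  + by move=> s; rewrite q'q mem_trace_rcons mem_rcons inE => /qw->;
      rewrite orbT.
- move=> z q u s q' _ [w [uE zE wN qw]] [qE q'q] zN; exists w; split=> //.
    by rewrite -qE.
  move=> s'; rewrite q'q !inE => /predU1P[->|]; last exact: qw.
  by rewrite -zN zE mem_trace_end.
Qed.

(** All ends located at [z] are recorded, one bounce each; both are there when the interval is
    reduced to 0. *)
Lemma reader_touch N z0 z (b : m.-bseq bool) (A : {set bool}) u :
  run (W := reader) N z0 reader0 z (b, A) u ->
  run (W := reader) N z0 reader0 z (b, A :|: [set s | nseq (N s) s == z]) u.
Proof.
move=> r; have touch (l : seq bool) : all (fun s => nseq (N s) s == z) l ->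
    run (W := reader) N z0 reader0 z (b, [set s in l] :|: A) u.
  elim: l => [_|s l IH /= /andP[/eqP zs /IH{}IH]].
    by rewrite (_ : [set s in [::]] = set0) ?set0U //; apply/setP => s;
      rewrite !inE.
  apply: (run_bn (W := reader) (s := s)) IH _ _; last by rewrite zs.
  by split=> //=; rewrite set_cons setUA.
have := touch [seq s <- [:: true; false] | nseq (N s) s == z] (filter_all _ _).
rewrite setUC; set B := [set s in _];
  rewrite (_ : B = [set s | nseq (N s) s == z]) //.
by apply/setP => s; rewrite !inE mem_filter; case: s; rewrite andbT.
Qed.

Definition touched N z0 w := [set s | nseq (N s) s \in trace z0 w].

Lemma touched_rcons N z0 w g : touched N z0 (rcons w g) =
  touched N z0 w :|: [set s | nseq (N s) s == walk_end z0 (rcons w g)].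
Proof. by apply/setP => s; rewrite !inE mem_trace_rcons mem_rcons inE orbC. Qed.

Lemma reader_walk N z0 w w' (b : m.-bseq bool) u : b = w' :> seq bool ->
  (forall y s, y \in trace z0 (w ++ w') -> count_mem s y <= N s) ->
  run (W := reader) N z0 reader0 (walk_end z0 w) (b, touched N z0 w) u ->
  run (W := reader) N z0 reader0 (walk_end z0 (w ++ w'))
    ([bseq], touched N z0 (w ++ w')) u.
Proof.
elim: w' w b => [|g w' IH] w b bw' wN r.
  by rewrite cats0; rewrite (_ : [bseq] = b) //; apply: val_inj.
have w'm : size w' <= m by have := size_bseq b; rewrite bw'; apply: ltnW.
rewrite -cat_rcons in wN *; apply: (IH _ (Bseq w'm)) => //.
rewrite touched_rcons; apply: reader_touch.
rewrite /walk_end foldl_rcons -/walk_end; apply: run_mv r _ _ => //.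
rewrite -[step _ _]/(foldl step (walk_end z0 w) [:: g]) -foldl_cat cats1.
by apply: wN; rewrite mem_trace_cat inE mem_trace_end.
Qed.

Lemma reader_complete N z0 u :
  (forall y s, y \in trace z0 (expand u) -> count_mem s y <= N s) ->
  run (W := reader) N z0 reader0 (walk_end z0 (expand u))
    ([bseq], touched N z0 (expand u)) u.
Proof.
elim/last_ind: u => [_|u t IH].
  rewrite (_ : touched _ _ _ = set0 :|: [set s | nseq (N s) s == z0]);
    last first.
    by apply/setP => s; rewrite !inE.
  by apply: reader_touch; apply: run_nil.
rewrite expand_rcons => uN; have tm : size (lw t) <= m.
  exact: (leq_bigmax t).
apply: (reader_walk (b := Bseq tm)) => //.
apply: run_rd (IH _) _ => // y s yu; apply: uN.
by rewrite mem_trace_cat inE yu.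
Qed.

(** The moves stay within the bounds and the state [readerT] certifies both contacts, which together
    is [spans]. The start is assumed within the bounds because a run checks only the positions it
    moves to. *)
Theorem reader_run N z0 z u : (forall s, count_mem s z0 <= N s) ->
  run (W := reader) N z0 reader0 z readerT u <->
  spans N z0 (expand u) /\ z = walk_end z0 (expand u).
Proof.
move=> z0N; split=> [/(reader_sound z0N)[w [-> -> wN wT]]|[[uN uT] ->]].
  by rewrite cats0; split=> //; split=> // s; apply: wT; rewrite inE.
rewrite /readerT (_ : setT = touched N z0 (expand u));
  first exact: reader_complete.
by apply/setP => s; rewrite !inE uT.
Qed.

End Reader.

(** * The word problems as conditions on runs of the reader *)

Section Generators.
Variable X : {fset FIM_ 1}.

Definition letter_word (t : X + X) : sword 'I_1 :=
  match t with inl x => fim_repr (val x) | inr x => winv (fim_repr (val x)) end.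

Definition letter_walk t := map dir (letter_word t).

Local Notation ex := (expand letter_walk).

Lemma wevalE (u : sword X) : weval u = fim_class (flatten (map letter_word u)).
Proof.
rewrite /weval; elim: u => [|t u IH]; first by rewrite big_nil.
rewrite big_cons IH /= -fim_mulE; congr (fim_mul _ _).
by case: t => x /=; rewrite -?fim_invE fim_reprK.
Qed.

Lemma expandE u : ex u = map dir (flatten (map letter_word u)).
Proof. by rewrite map_flatten -map_comp. Qed.

Lemma weval_eq (u v : sword X) : weval u = weval v <->
  exists N, [/\ spans N [::] (ex u), spans N [::] (ex v)
    & walk_end [::] (ex u) = walk_end [::] (ex v)].
Proof. by rewrite !wevalE !expandE; apply: fim_class_eq. Qed.

Lemma expand_winv u : ex (winv u) = flip (ex u).
Proof.
elim: u => // t u IH; rewrite -cat1s winv_cat !expand_cat IH flip_cat.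
congr (_ ++ _); rewrite /expand /= !cats0 /letter_walk -dir_winv; congr map.
by case: t => x /=; rewrite ?winvK.
Qed.

Lemma spans_flip N z w : constant z -> spans N z w ->
  spans N (walk_end z w) (flip w).
Proof.
move=> /(walk_flip w)[_ tE] [le_N in_tr].
by split=> [y s|s]; rewrite tE; [apply: le_N|apply: in_tr].
Qed.

Lemma WPE w : WP X w <-> exists N z u v,
  [/\ w = map Some u ++ None :: map Some v,
      run (W := reader letter_walk) N [::] (reader0 _) z (readerT _) u &
      run (W := reader letter_walk) N z (reader0 _) [::] (readerT _) v].
Proof.
split=> [[u [v [/weval_eq[N [uN vN uvE]] ->]]]|[N [z [u [v [-> ru rv]]]]]].
  exists N, (walk_end [::] (ex u)), u, (winv v); split=> //.
    by apply/reader_run.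
  (* The second run starts at the end of the first walk, which lies in the interval as a visited
     position. *)
  apply/reader_run => [s|]; first by case: uN => + _; apply;
    apply: mem_trace_end.
  rewrite expand_winv uvE; split; first exact: spans_flip.
  by have [] := walk_flip (ex v) (isT : constant [::]).
move: ru => /reader_run[] // uN zE.
have zc : constant z by rewrite zE constant_walk_end.
have zN s : count_mem s z <= N s by rewrite zE; case: uN => + _; apply;
  apply: mem_trace_end.
move: rv => /(reader_run _ _ _ zN)[vN z0E].
(* Here [v] is the word after the separator, so the second word of the pair is its formal
   inverse. *)
exists u, (winv v); rewrite winvK; split=> //; apply/weval_eq; exists N.
have [vzE _] := walk_flip (ex v) zc; rewrite expand_winv z0E; split=> //.
  by rewrite -z0E.
  exact: spans_flip.
by rewrite vzE -z0E.
Qed.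

Lemma two_tape_WPE u v : two_tape_WP X u v <-> exists N z,
  run (W := reader letter_walk) N [::] (reader0 _) z (readerT _) u /\
  run (W := reader letter_walk) N [::] (reader0 _) z (readerT _) v.
Proof.
rewrite /two_tape_WP weval_eq; split=> [[N [uN vN uvE]]|[N [z []]]].
  by exists N, (walk_end [::] (ex u)); split; apply/reader_run.
by move=> /reader_run[] // uN -> /reader_run[] // vN uvE; exists N.
Qed.

End Generators.

Theorem corollary1 (X : {fset FIM_ 1}) (genX : inv_generates X) :
  is_ET0L (WP X) /\ is_ET0L_rel (two_tape_WP X).
Proof.
split.
  have [G GP] := separated_runs_et0l (reader0 (@letter_walk X)) (readerT _).
  by exists G => w; rewrite WPE GP.
have [L LE LP] := paired_runs_et0l (reader0 (@letter_walk X)) (readerT _).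
by exists L => // u v; rewrite two_tape_WPE LP.
Qed.
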